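(* For every $C>0$ there exists a constant $c_{\mathrm{KKL}}>0$ depending only on $C$ such that the following holds. Let $n\ge1$ with $C\le\sqrt{n}$ and let $f:\{-1,1\}^n\to\{-1,1\}$ satisfy $\mathrm{Inf}_i(f)\le C\cdot\mathrm{Var}(f)\frac{\log n}{n}$ for all $i\in\{1,\dots,n\}$. Then $$\mu(\partial^{+}f)\ge c_{\mathrm{KKL}}\mathrm{Var}(f)\quad\text{and}\quad\mu(\partial^{-}f)\ge c_{\mathrm{KKL}}\mathrm{Var}(f).$$
   Context: $\mu$ is the uniform probability measure on $\{-1,1\}^n$; $\mathrm{Var}$ is taken with respect to $\mu$. $y^{\oplus i}$ is $y$ with the $i$-th coordinate flipped. $\mathrm{Inf}_i(f)=\mu(\{y: f(y)\ne f(y^{\oplus i})\})$. The inner vertex boundary is $\partial^+f=\{y: \exists i,\ f(y)=1,\ f(y^{\oplus i})=-1\}$ and the outer vertex boundary is $\partial^-f=\{y:\exists i,\ f(y)=-1,\ f(y^{\oplus i})=1\}$. $\log$ is the natural logarithm. *)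

(* Defs.v *)
From mathcomp Require Import all_boot all_order all_algebra.
From mathcomp Require Import reals.

Set Implicit Arguments.
Unset Strict Implicit.
Unset Printing Implicit Defensive.

Import GRing.Theory.

Local Open Scope ring_scope.

(* The two-point set {-1,1} is encoded by [bool],
   with [true] for 1 and [false] for -1; [pm1] is the value in [R]. *)
Definition pm1 (R : realType) (b : bool) : R := if b then 1 else -1.

Definition cube (n : nat) : finType := {ffun 'I_n -> bool}.

Definition flip (n : nat) (y : cube n) (i : 'I_n) : cube n :=
  [ffun j => if j == i then ~~ y j else y j].

Definition mu (R : realType) (n : nat) (A : {set cube n}) : R :=
  #|A|%:R / #|cube n|%:R.

Definition mean (R : realType) (n : nat) (g : cube n -> R) : R :=
  \sum_(y : cube n) g y * mu R [set y].

Definition Var (R : realType) (n : nat) (f : cube n -> bool) : R :=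
  mean (fun y => (pm1 R (f y) - mean (fun z => pm1 R (f z))) ^+ 2).

Definition Inf (R : realType) (n : nat) (f : cube n -> bool) (i : 'I_n) : R :=
  mu R [set y | f y != f (flip y i)].

Definition inner_boundary (n : nat) (f : cube n -> bool) : {set cube n} :=
  [set y | [exists i : 'I_n, (f y == true) && (f (flip y i) == false)]].

Definition outer_boundary (n : nat) (f : cube n -> bool) : {set cube n} :=
  [set y | [exists i : 'I_n, (f y == false) && (f (flip y i) == true)]].

(* Main.v *)
Require Import Defs.
From mathcomp Require Import all_boot all_order all_algebra.
From mathcomp Require Import boolp reals exp.
From mathcomp Require Import ring lra zify.

(** Write [F] for the function [f] with values in {-1,1}, [W_k] for its Fourier
weight at level [k], [D_i F] for the discrete derivative (half the difference
across direction [i], with the sign of the coordinate), [T_rho] for the noise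
operator, and [I] for the total influence. Everything is read off the
polynomial [p(t) = sum_k W_k t^k]: one has [Var f = p(1) - p(0)], [I = p'(1)]
and [p'(rho) = sum_i E (D_i F * T_rho (D_i F))].

The geometric input is the inequality
  [(1 - rho^2) p'(rho)^2 <= 4 I mu(S)]                                 (1)
for [S] either of the two vertex boundaries ([side_boundary_ge]). Every
sensitive edge has exactly one endpoint on a given side and [T_rho (D_i F)]
does not see coordinate [i], so [p'(rho)] is twice the mean over [S] of
[sum_i D_i F * T_rho (D_i F)] restricted to that side. Cauchy-Schwarz over the
pairs (direction, point) gives [I] for one factor; the other one is the mean
over [S] of [sum_i (T_rho (D_i F))^2], which is pointwise at most
[1 / (1 - rho^2)] because [F] is bounded by 1 ([noise_sqr_ge]).

It remains to choose [rho] so that [p'(rho)] is large. With [n] of size about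
[256^d], the hypothesis says that [I <= D Var f] with [D] of order [d], so by
Markov's inequality at most a quarter of the variance lies at levels above
[4 D]. Hypercontractivity ([bonami]) gives the KKL bound
[E (D_i F * T_(1/4) (D_i F)) <= Inf_i^(3/2)] ([level_influence]), and since all
influences are tiny, at most another quarter lies at levels up to [d]. Half of
the variance is thus at levels between [d] and [4 D]; for [1 - rho] of order
[1/d] the noise damps these levels by a constant factor only, so that [p'(rho)]
is at least of order [d Var f] ([deriv_horner_ge]). Substituting in (1), the
powers of [d] cancel and leave [mu(S) >= c Var f]
([Var_le_side_boundary_log]). When [n] is bounded in terms of [C], the trivial
bound [Var f <= 2^n mu(S)] is enough. *)

Set Implicit Arguments.
Unset Strict Implicit.
Unset Printing Implicit Defensive.

Import Order.TTheory GRing.Theory Num.Theory.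

Local Open Scope ring_scope.

(** * Averages and derivatives along one coordinate *)

Section Analysis.
Variables (R : realType) (n : nat).
Implicit Types (c rho sigma t : R) (g h a b : cube n -> R) (i j : 'I_n).
Implicit Types (x y : cube n) (s : seq 'I_n).

Local Notation chi i x := (pm1 R (x i)).

Lemma pm1_sqr (b : bool) : pm1 R b ^+ 2 = 1.
Proof. by case: b; rewrite /pm1 ?sqrrN expr1n. Qed.

Lemma flip_at x i : flip x i i = ~~ x i.
Proof. by rewrite ffunE eqxx. Qed.

Lemma flip_off x i j : j != i -> flip x i j = x j.
Proof. by rewrite ffunE => /negbTE ->. Qed.

Lemma flipK i : involutive (fun x => flip x i).
Proof.
move=> x; apply/ffunP => j; rewrite !ffunE.
by case: eqP => // ->; rewrite negbK.
Qed.

Lemma flipC x i j : flip (flip x i) j = flip (flip x j) i.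
Proof.
apply/ffunP => k; rewrite !ffunE.
by case: (k == i); case: (k == j).
Qed.

Lemma chi_flip x i : chi i (flip x i) = - chi i x.
Proof. by rewrite flip_at; case: (x i); rewrite /pm1 //= opprK. Qed.

Definition invariant_at i g := forall x, g (flip x i) = g x.

Definition avg i g x : R := (g x + g (flip x i)) / 2.

Definition der i g x : R := chi i x * (g x - g (flip x i)) / 2.

(** The Fourier expansion of [g] in the single coordinate [i]: every induction
below splits a function this way, both parts being independent of [i]. *)
Lemma avg_der i g x : g x = avg i g x + chi i x * der i g x.
Proof. by rewrite /avg /der !mulrA -expr2 pm1_sqr; field. Qed.

Lemma invariant_avg i j g : invariant_at i g -> invariant_at i (avg j g).
Proof. by move=> ig x; rewrite /avg flipC !ig. Qed.

Lemma invariant_der i j g : i != j -> invariant_at i g -> invariant_at i (der j g).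
Proof. by move=> ij ig x; rewrite /der flipC !ig flip_off // eq_sym. Qed.

Lemma avg_invariant i g : invariant_at i (avg i g).
Proof. by move=> x; rewrite /avg flipK addrC. Qed.

Lemma der_invariant i g : invariant_at i (der i g).
Proof. by move=> x; rewrite /der flipK chi_flip; ring. Qed.

Lemma avg_id i g : invariant_at i g -> avg i g = g.
Proof. by move=> ig; apply/funext => x; rewrite /avg ig; field. Qed.

Lemma der_id i g : invariant_at i g -> der i g = fun=> 0.
Proof. by move=> ig; apply/funext => x; rewrite /der ig; field. Qed.

Lemma avg_derC i j g : i != j -> avg i (der j g) = der j (avg i g).
Proof.
move=> ij; apply/funext => x; rewrite /avg /der flipC flip_off 1?eq_sym //.
by field.
Qed.

Lemma derC i j g : i != j -> der i (der j g) = der j (der i g).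
Proof.
move=> ij; apply/funext => x; rewrite /der flipC !flip_off // 1?eq_sym //.
by field.
Qed.

Lemma avg_lin i c a b :
  avg i (fun x => a x + c * b x) = fun x => avg i a x + c * avg i b x.
Proof. by apply/funext => x; rewrite /avg; field. Qed.

Lemma der_lin i c a b :
  der i (fun x => a x + c * b x) = fun x => der i a x + c * der i b x.
Proof. by apply/funext => x; rewrite /der; field. Qed.

Lemma avg_sqr i g :
  avg i (fun x => g x ^+ 2) = fun x => avg i g x ^+ 2 + 1 * der i g x ^+ 2.
Proof.
apply/funext => x; rewrite /avg /der !exprMn pm1_sqr; by field.
Qed.

Lemma der_sqr i g :
  der i (fun x => g x ^+ 2) = fun x => 0 + 2 * (avg i g x * der i g x).
Proof. by apply/funext => x; rewrite /avg /der; field. Qed.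

(** * Means and the Cauchy-Schwarz inequality *)

Lemma card_cube_neq0 : #|cube n|%:R != 0 :> R.
Proof. by rewrite pnatr_eq0 -lt0n; apply/card_gt0P; exists [ffun=> true]. Qed.

Lemma meanE g : mean g = (\sum_x g x) / #|cube n|%:R.
Proof.
rewrite /mean /mu mulr_suml; apply: eq_bigr => x _.
by rewrite cards1 mul1r.
Qed.

Lemma mean_lin c a b : mean (fun x => a x + c * b x) = mean a + c * mean b.
Proof. by rewrite !meanE big_split /= -mulr_sumr mulrDl mulrA. Qed.

Lemma mean_cst c : mean (fun _ : cube n => c) = c.
Proof.
by rewrite meanE sumr_const -[c *+ _]mulr_natr mulfK ?card_cube_neq0.
Qed.

Lemma mean_sum (I : Type) (r : seq I) (G : I -> cube n -> R) :
  mean (fun x => \sum_(k <- r) G k x) = \sum_(k <- r) mean (G k).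
Proof.
elim: r => [|k r IH].
  rewrite big_nil -[RHS](mean_cst 0); congr mean.
  by apply/funext => x; rewrite big_nil.
rewrite big_cons -IH -[X in _ + X]mul1r -mean_lin; congr mean.
by apply/funext => x; rewrite big_cons mul1r.
Qed.

Lemma ler_mean g h : (forall x, g x <= h x) -> mean g <= mean h.
Proof.
move=> gh; rewrite !meanE ler_wpM2r ?invr_ge0 ?ler0n //.
by apply: ler_sum => x _.
Qed.

Lemma mean_ge0 g : (forall x, 0 <= g x) -> 0 <= mean g.
Proof. by move=> g0; rewrite -(mean_cst 0); apply: ler_mean. Qed.

Lemma mu_mean (A : {set cube n}) : mu R A = mean (fun x => (x \in A)%:R).
Proof.
rewrite meanE /mu; congr (_ / _); rewrite -sum1_card natr_sum [LHS]big_mkcond /=.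
by apply: eq_bigr => x _; case: (x \in A).
Qed.

Lemma mean_flip i g : mean (fun x => g (flip x i)) = mean g.
Proof.
rewrite !meanE; congr (_ / _).
by rewrite [RHS](reindex_inj (can_inj (flipK i))).
Qed.

Lemma mean_avg i g : mean (avg i g) = mean g.
Proof.
rewrite (_ : avg i g = fun x => 2^-1 * g x + 2^-1 * g (flip x i)); last first.
  by apply/funext => x; rewrite /avg; field.
rewrite mean_lin mean_flip (_ : (fun x => _) = fun x => 0 + 2^-1 * g x).
  by rewrite mean_lin mean_cst; field.
by apply/funext => x; ring.
Qed.

(** The quadratic [sum (u + c v)^2] in [c] is nonnegative. *)
Lemma sum_CauchySchwarz (I : finType) (u v : I -> R) :
  (\sum_k u k * v k) ^+ 2 <= (\sum_k u k ^+ 2) * (\sum_k v k ^+ 2).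
Proof.
have H c : 0 <= (\sum_k u k ^+ 2) + c * ((2 * \sum_k u k * v k) + c * \sum_k v k ^+ 2).
  rewrite !mulr_sumr -big_split /= mulr_sumr -big_split /=.
  by apply: sumr_ge0 => k _; have := sqr_ge0 (u k + c * v k); nra.
have V0 : 0 <= \sum_k v k ^+ 2 by apply: sumr_ge0 => k _; apply: sqr_ge0.
move: V0 H; move: (\sum_k u k ^+ 2) (\sum_k u k * v k) (\sum_k v k ^+ 2).
move=> A B V; rewrite le_eqVlt => /orP[/eqP <- H|V0 H].
  have [->|B0] := eqVneq B 0; first by rewrite expr0n /= mulr0.
  have := H (- (A + 1) / (2 * B)); rewrite mulr0 addr0.
  have -> : - (A + 1) / (2 * B) * (2 * B) = - (A + 1) by field.
  lra.
have := H (- B / V).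
have -> : A + - B / V * (2 * B + - B / V * V) = A - B ^+ 2 / V.
  by field; rewrite gt_eqF.
by rewrite subr_ge0 ler_pdivrMr.
Qed.

Lemma mean_CauchySchwarz g h :
  mean (fun x => g x * h x) ^+ 2
  <= mean (fun x => g x ^+ 2) * mean (fun x => h x ^+ 2).
Proof.
rewrite !meanE exprMn [leRHS]mulrACA -expr2 ler_wpM2r ?sqr_ge0 //.
exact: sum_CauchySchwarz.
Qed.

(** * The noise operator and the level polynomial *)

(** The noise operator on the coordinates in [s]: a Fourier character over a set
[A] contained in [s] is multiplied by [rho ^+ #|A|]. Defining it by splitting
off one coordinate at a time replaces Fourier analysis by induction on [s]. *)
Fixpoint noise rho s g : cube n -> R :=
  if s is i :: s' then
    fun x => noise rho s' (avg i g) x + rho * chi i x * noise rho s' (der i g) x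
  else g.

(** When [g] depends only on the coordinates in [s], the coefficient of ['X^k] is
the Fourier weight of [g] at level [k], that is, the sum of the squared Fourier
coefficients over the sets of size [k]. *)
Fixpoint level_poly s g : {poly R} :=
  if s is i :: s' then level_poly s' (avg i g) + 'X * level_poly s' (der i g)
  else (mean (fun x => g x ^+ 2))%:P.

Lemma noise_lin rho s c a b x :
  noise rho s (fun y => a y + c * b y) x = noise rho s a x + c * noise rho s b x.
Proof.
elim: s a b => [|i s IH] a b //=.
by rewrite avg_lin der_lin !IH; ring.
Qed.

Lemma noise_cst rho s c x : noise rho s (fun=> c) x = c.
Proof.
have noise0 s' : noise rho s' (fun=> 0) x = 0.
  have := noise_lin rho s' (-1) (fun=> 0) (fun=> 0) x.
  rewrite (_ : (fun=> _) = fun=> 0); first by lra.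
  by apply/funext => y; ring.
elim: s => [|i s IH] //=.
by rewrite der_id // avg_id // IH noise0 mulr0 addr0.
Qed.

Lemma noise1 s g : noise 1 s g = g.
Proof.
elim: s g => [|i s IH] g //=; apply/funext => x.
by rewrite !IH mul1r -avg_der.
Qed.

Lemma invariant_noise rho s i g :
  invariant_at i g -> invariant_at i (noise rho s g).
Proof.
elim: s g => [|j s IH] g ig //= x.
have [<-|ij] := eqVneq i j.
  by rewrite avg_id // der_id // !noise_cst IH // !mulr0.
rewrite !IH ?flip_off 1?eq_sym //; first exact: invariant_der.
exact: invariant_avg.
Qed.

(** The reverse local Poincare inequality: the conditional variance of [g] under
the noise centred at [x] dominates the energy of its linear part. Its use is
the case [g ^+ 2 = 1], where it bounds the gradient of the smoothed function
uniformly in [x]. For a single coordinate the variance is exactly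
[1 - rho^2] times the squared derivative; the variances of successive
coordinates add up, and the induction hypothesis for [der i g] supplies
Jensen's inequality for the last term. *)
Lemma noise_sqr_ge rho s g x : uniq s -> rho ^+ 2 <= 1 ->
  (1 - rho ^+ 2) * \sum_(j <- s) noise rho s (der j g) x ^+ 2
  <= noise rho s (fun y => g y ^+ 2) x - noise rho s g x ^+ 2.
Proof.
move=> + rho1; elim: s g => [|i s IH] g /=; first by rewrite big_nil mulr0 subrr.
move=> /andP[is_ us].
rewrite big_cons avg_id; last exact: der_invariant.
rewrite (der_id (@der_invariant i g)) noise_cst mulr0 addr0.
rewrite avg_sqr der_sqr !noise_lin noise_cst.
set c := rho * _.
have c2 : c ^+ 2 = rho ^+ 2 by rewrite /c exprMn pm1_sqr mulr1.
(* At the fixed point [x] the coordinate [i] is a constant, so the induction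
   hypothesis can be used for the function [h] where it has been frozen. *)
pose h y := avg i g y + c * der i g y.
have -> : \sum_(j <- s) (noise rho s (avg i (der j g)) x +
             c * noise rho s (der i (der j g)) x) ^+ 2
    = \sum_(j <- s) noise rho s (der j h) x ^+ 2.
  rewrite big_seq [RHS]big_seq; apply: eq_bigr => j js.
  have ij : i != j by apply: contraNneq is_ => ->.
  by rewrite avg_derC // derC // /h der_lin noise_lin.
have -> : noise rho s (avg i g) x + c * noise rho s (der i g) x = noise rho s h x.
  by rewrite /h noise_lin.
have := IH h us.
rewrite (_ : (fun y => h y ^+ 2) = fun y =>
   (avg i g y ^+ 2 + 2 * c * (avg i g y * der i g y))
   + c ^+ 2 * der i g y ^+ 2); last first.
  by apply/funext => y; rewrite /h; ring.
rewrite !noise_lin c2.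
have r0 : 0 <= 1 - rho ^+ 2 by rewrite subr_ge0.
have jensen : 0 <= noise rho s (fun y => der i g y ^+ 2) x - noise rho s (der i g) x ^+ 2.
  apply: le_trans (IH _ us); apply: mulr_ge0 => //.
  by apply: sumr_ge0 => j _; apply: sqr_ge0.
have := mulr_ge0 r0 jensen.
rewrite mulrDr; lra.
Qed.

(** Orthogonality of the two parts of the expansion along [i]. *)
Lemma mean_product i sigma rho a b a' b' :
  invariant_at i a -> invariant_at i b -> invariant_at i a' -> invariant_at i b' ->
  mean (fun x => (a x + sigma * chi i x * b x) * (a' x + rho * chi i x * b' x))
  = mean (fun x => a x * a' x) + sigma * rho * mean (fun x => b x * b' x).
Proof.
move=> ia ib ia' ib'.
rewrite -mean_lin -(mean_avg i); congr mean; apply/funext => x.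
rewrite /avg chi_flip ia ib ia' ib'; move: (pm1_sqr (x i)); set c := chi i x.
move=> c2.
transitivity (a x * a' x + sigma * rho * c ^+ 2 * (b x * b' x)); first by field.
by rewrite c2 mulr1.
Qed.

Lemma mean_noise sigma rho s g :
  mean (fun x => noise sigma s g x * noise rho s g x)
  = (level_poly s g).[sigma * rho].
Proof.
elim: s g => [|i s IH] g /=; first by rewrite hornerC.
rewrite mean_product ?IH ?hornerE //.
all: apply: invariant_noise; by [exact: avg_invariant | exact: der_invariant].
Qed.

Lemma level_poly_ge0 s g k : 0 <= (level_poly s g)`_k.
Proof.
elim: s g k => [|i s IH] g k /=.
  by rewrite coefC; case: eqP => // _; apply: mean_ge0 => x; apply: sqr_ge0.
by rewrite coefD coefXM addr_ge0 //; case: eqP.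
Qed.

Lemma horner_level_ge0 s g t : 0 <= t -> 0 <= (level_poly s g).[t].
Proof.
move=> t0; rewrite horner_coef; apply: sumr_ge0 => k _.
by rewrite mulr_ge0 ?exprn_ge0 ?level_poly_ge0.
Qed.

Lemma level_poly0 s : level_poly s (fun=> 0) = 0.
Proof.
elim: s => [|i s IH] /=; last by rewrite avg_id // der_id // IH mulr0 addr0.
by rewrite mean_cst expr0n.
Qed.

(** A character over [A] contributes to the derivative [#|A|] times, once for each
coordinate that [der] can remove from [A]. *)
Lemma deriv_level_poly s g : uniq s ->
  (level_poly s g)^`() = \sum_(j <- s) level_poly s (der j g).
Proof.
elim: s g => [|i s IH] g /=; first by rewrite derivC big_nil.
move=> /andP[is_ us].
rewrite big_cons (avg_id (@der_invariant i g)).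
rewrite (der_id (@der_invariant i g)) level_poly0 mulr0 addr0.
rewrite derivD derivM derivX mul1r !IH // addrCA; congr (_ + _).
rewrite mulr_sumr -big_split big_seq [RHS]big_seq /=; apply: eq_bigr => j js.
have ij : i != j by apply: contraNneq is_ => ->.
by rewrite avg_derC // (derC _ ij).
Qed.

(** * Functions of few coordinates and hypercontractivity *)

Definition supported s g := forall i, i \notin s -> invariant_at i g.

Lemma supported_avg i s g : supported (i :: s) g -> supported s (avg i g).
Proof.
move=> sg j js; have [->|ji] := eqVneq j i; first exact: avg_invariant.
by apply: invariant_avg; apply: sg; rewrite inE negb_or ji.
Qed.

Lemma supported_der i s g : supported (i :: s) g -> supported s (der i g).
Proof.
move=> sg j js; have [->|ji] := eqVneq j i; first exact: der_invariant.
by apply: invariant_der => //; apply: sg; rewrite inE negb_or ji.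
Qed.

(** Any two points are joined by a sequence of flips. *)
Lemma supported_nil g x : supported [::] g -> g = fun=> g x.
Proof.
move=> sg; apply/funext => y.
suff H s (z : cube n) : (forall i, i \notin s -> z i = x i) -> g z = g x.
  by apply: (H (enum 'I_n)) => i; rewrite mem_enum.
elim: s z => [|i s IH] z zx; first by congr g; apply/ffunP => i; apply: zx.
have [zi|zi] := eqVneq (z i) (x i).
  apply: IH => j js; have [->//|ji] := eqVneq j i.
  by apply: zx; rewrite inE negb_or ji.
rewrite -(sg i) //; apply: IH => j js; have [->|ji] := eqVneq j i.
  by rewrite flip_at; move: zi; case: (z i); case: (x i).
by rewrite flip_off //; apply: zx; rewrite inE negb_or ji.
Qed.

Lemma level_poly_at0 s g : supported s g -> (level_poly s g).[0] = mean g ^+ 2.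
Proof.
elim: s g => [|i s IH] g sg /=.
  by rewrite hornerC (supported_nil [ffun=> true] sg) !mean_cst.
by rewrite !hornerE IH ?mean_avg //; exact: supported_avg.
Qed.

(** The odd powers of the coordinate average out. *)
Lemma mean_pow4 i c a b : invariant_at i a -> invariant_at i b ->
  mean (fun x => (a x + c * chi i x * b x) ^+ 4)
  = mean (fun x => a x ^+ 4) + 6 * c ^+ 2 * mean (fun x => a x ^+ 2 * b x ^+ 2)
    + c ^+ 4 * mean (fun x => b x ^+ 4).
Proof.
move=> ia ib; rewrite -!mean_lin -(mean_avg i); congr mean; apply/funext => x.
rewrite /avg chi_flip ia ib; move: (pm1_sqr (x i)); set e := chi i x => e2.
transitivity (a x ^+ 4 + 6 * c ^+ 2 * e ^+ 2 * (a x ^+ 2 * b x ^+ 2)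
  + c ^+ 4 * (e ^+ 2) ^+ 2 * b x ^+ 4); first by field.
by rewrite e2 expr1n !mulr1.
Qed.

(** Bonami's inequality: the fourth moment of [noise rho s g] is at most the square
of the second moment of [noise (2 * rho) s g], since the latter moment is
[(level_poly s g).[4 * rho ^+ 2]]. The factor 4 (3 would do) makes the expansion
of the fourth power along one coordinate fit below the square of the sum: its
cross term [6 * rho ^+ 2] is at most [2 * 4 * rho ^+ 2]. The formulation in terms
of the level polynomial is what makes the induction close. *)
Lemma bonami rho s g : supported s g ->
  mean (fun x => noise rho s g x ^+ 4) <= (level_poly s g).[4 * rho ^+ 2] ^+ 2.
Proof.
elim: s g => [|i s IH] g sg /=.
  by rewrite hornerC (supported_nil [ffun=> true] sg) !mean_cst -exprM.
rewrite mean_pow4; [|exact/invariant_noise/avg_invariant|exact/invariant_noise/der_invariant].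
rewrite hornerD hornerM hornerX.
have := IH _ (supported_avg sg); have := IH _ (supported_der sg).
have t0 : 0 <= 4 * rho ^+ 2 by rewrite mulr_ge0 ?sqr_ge0.
have := horner_level_ge0 s (avg i g) t0; have := horner_level_ge0 s (der i g) t0.
move: (level_poly s (avg i g)).[_] (level_poly s (der i g)).[_] => p q q0 p0.
set A := noise rho s (avg i g); set B := noise rho s (der i g) => B4 A4.
have AB : mean (fun x => A x ^+ 2 * B x ^+ 2) <= p * q.
  rewrite -ler_sqr ?nnegrE ?mulr_ge0 //; last first.
    by apply: mean_ge0 => x; rewrite mulr_ge0 ?sqr_ge0.
  apply: le_trans (mean_CauchySchwarz _ _) _; rewrite exprMn.
  have sq4 u : (fun x => (u x ^+ 2) ^+ 2) = fun x : cube n => u x ^+ 4 :> R.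
    by apply/funext => x; rewrite -exprM.
  by rewrite !sq4; apply: ler_pM => //; apply: mean_ge0 => x; rewrite exprn_even_ge0.
have r2 : 0 <= rho ^+ 2 by apply: sqr_ge0.
have h1 : 6 * rho ^+ 2 * mean (fun x => A x ^+ 2 * B x ^+ 2) <= 6 * rho ^+ 2 * (p * q).
  by rewrite ler_wpM2l // mulr_ge0.
have h2 : rho ^+ 4 * mean (fun x => B x ^+ 4) <= rho ^+ 4 * q ^+ 2.
  by rewrite ler_wpM2l // exprn_even_ge0.
have h3 : 0 <= rho ^+ 2 * (p * q) by apply: mulr_ge0 => //; apply: mulr_ge0.
have h4 : 0 <= rho ^+ 4 * q ^+ 2 by apply: mulr_ge0; rewrite ?sqr_ge0 ?exprn_even_ge0.
have -> : (p + 4 * rho ^+ 2 * q) ^+ 2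
    = p ^+ 2 + 8 * (rho ^+ 2 * (p * q)) + 16 * (rho ^+ 4 * q ^+ 2) by ring.
lra.
Qed.

End Analysis.

(** * Boolean functions: variance, influences and boundaries *)

Section Boolean.
Variables (R : realType) (n : nat).
Implicit Types (rho : R) (f : cube n -> bool) (g h : cube n -> R) (i : 'I_n) (b : bool).

Local Notation coords := (enum 'I_n).

Definition sign f (x : cube n) : R := pm1 R (f x).

Definition spectrum f : {poly R} := level_poly coords (sign f).

(** The inner boundary is the case [b = true], the outer one [b = false]. *)
Definition side_boundary b f : {set cube n} :=
  [set y | [exists i : 'I_n, (f y == b) && (f (flip y i) == ~~ b)]].

Lemma supported_coords g : supported coords g.
Proof. by move=> i; rewrite mem_enum. Qed.

Lemma mean_scale c g : mean (fun x => c * g x) = c * mean g.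
Proof.
rewrite -[RHS]add0r -[X in _ = X + _](mean_cst n 0) -mean_lin; congr mean.
by apply/funext => x; rewrite add0r.
Qed.

Lemma horner_level1 s g : (level_poly s g).[1] = mean (fun x => g x ^+ 2).
Proof. by rewrite -[1]mulr1 -mean_noise noise1. Qed.

Lemma sign_sqr f : (fun x => sign f x ^+ 2) = fun=> 1.
Proof. by apply/funext => x; rewrite /sign pm1_sqr. Qed.

Lemma Var_spectrum f : Var R f = (spectrum f).[1] - (spectrum f).[0].
Proof.
rewrite /spectrum horner_level1 level_poly_at0; last exact: supported_coords.
rewrite /Var -/(sign f); set m := mean (sign f).
rewrite (_ : (fun y => (_ - m) ^+ 2) = fun y =>
  (sign f y ^+ 2 + - (2 * m) * sign f y) + m ^+ 2 * 1); last first.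
  by apply/funext => y; rewrite /sign; ring.
by rewrite !mean_lin mean_cst -/m; ring.
Qed.

Lemma Var_ge0 f : 0 <= Var R f.
Proof. by apply: mean_ge0 => x; apply: sqr_ge0. Qed.

Lemma Var_le1 f : Var R f <= 1.
Proof.
rewrite Var_spectrum /spectrum horner_level1 sign_sqr mean_cst.
by rewrite level_poly_at0 ?gerBl ?sqr_ge0 //; exact: supported_coords.
Qed.

Lemma der_sign_sqr f i x :
  der i (sign f) x ^+ 2 = (f x != f (flip x i))%:R.
Proof.
rewrite /der /sign !exprMn pm1_sqr.
by case: (f x); case: (f (flip x i)); rewrite /pm1 /=; field.
Qed.

Lemma mean_der_sign_sqr f i : mean (fun x => der i (sign f) x ^+ 2) = Inf R f i.
Proof.
rewrite /Inf mu_mean; congr mean; apply/funext => x.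
by rewrite inE der_sign_sqr.
Qed.

Lemma deriv_spectrum f rho :
  (spectrum f)^`().[rho] = \sum_i (level_poly coords (der i (sign f))).[rho].
Proof.
rewrite /spectrum deriv_level_poly ?enum_uniq // horner_sum big_enum /=.
by apply: eq_bigr.
Qed.

Lemma deriv_spectrum1 f : (spectrum f)^`().[1] = \sum_i Inf R f i.
Proof.
rewrite deriv_spectrum; apply: eq_bigr => i _.
by rewrite horner_level1 mean_der_sign_sqr.
Qed.

(** A sensitive edge has exactly one endpoint where [f] equals [b], and the two
endpoints contribute equally because neither [der i (sign f)] nor [h] depends
on coordinate [i]. *)
Lemma mean_der_side b f i h : invariant_at i h ->
  mean (fun x => der i (sign f) x * h x)
  = 2 * mean (fun x => (f x == b)%:R * der i (sign f) x * h x).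
Proof.
move=> ih; rewrite -(mean_avg i (fun x => (_ == b)%:R * _ * _)) -mean_scale.
congr mean; apply/funext => x; rewrite /avg /der flipK chi_flip ih /sign.
by case: (f x); case: (f (flip x i)); case: b; rewrite /pm1 /=; field.
Qed.

Lemma sum_mean_CauchySchwarz (u v : 'I_n -> cube n -> R) :
  (\sum_i mean (fun x => u i x * v i x)) ^+ 2
  <= (\sum_i mean (fun x => u i x ^+ 2)) * (\sum_i mean (fun x => v i x ^+ 2)).
Proof.
have E (w : 'I_n -> cube n -> R) :
    \sum_i mean (w i) = (\sum_p w p.1 p.2) / #|cube n|%:R.
  rewrite -(pair_big xpredT xpredT) /= mulr_suml.
  by apply: eq_bigr => i _; rewrite meanE.
rewrite !E exprMn [leRHS]mulrACA -expr2 ler_wpM2r ?sqr_ge0 //.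
exact: (sum_CauchySchwarz (fun p => u p.1 p.2) (fun p => v p.1 p.2)).
Qed.

(** The isoperimetric inequality behind the theorem; see the introduction. *)
Lemma side_boundary_ge b f rho : rho ^+ 2 <= 1 ->
  (1 - rho ^+ 2) * (spectrum f)^`().[rho] ^+ 2
  <= 4 * (\sum_i Inf R f i) * mu R (side_boundary b f).
Proof.
move=> rho1; set S := side_boundary b f.
have r0 : 0 <= 1 - rho ^+ 2 by rewrite subr_ge0.
pose N i := noise rho coords (der i (sign f)).
pose u i x := (f x == b)%:R * der i (sign f) x.
pose v i x := (x \in S)%:R * N i x.
have -> : (spectrum f)^`().[rho] = 2 * \sum_i mean (fun x => u i x * v i x).
  rewrite deriv_spectrum mulr_sumr; apply: eq_bigr => i _.
  rewrite -[rho]mul1r -mean_noise noise1 (mean_der_side b); last first.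
    by apply: invariant_noise; apply: der_invariant.
  congr (_ * mean _); apply/funext => x; rewrite /u /v mulrA; congr (_ * _).
  case: (boolP (x \in S)); rewrite ?mulr1 // mulr0 inE => /existsPn /(_ i).
  have [fx|_] := eqVneq (f x) b; last by rewrite mul0r.
  rewrite /= => nfx; have ffx : b = f (flip x i) by case: (f _) nfx; case: (b).
  by rewrite /der /sign fx -ffx subrr mulr0 mul0r mulr0.
have U : \sum_i mean (fun x => u i x ^+ 2) <= \sum_i Inf R f i.
  apply: ler_sum => i _; rewrite -mean_der_sign_sqr; apply: ler_mean => x.
  by rewrite /u exprMn ler_piMl ?sqr_ge0 //; case: (_ == b); rewrite ?expr1n ?expr0n.
have W : (1 - rho ^+ 2) * \sum_i mean (fun x => v i x ^+ 2) <= mu R S.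
  rewrite -mean_sum -mean_scale mu_mean; apply: ler_mean => x.
  rewrite /v; case: (x \in S) => /=; last first.
    by rewrite big1 ?mulr0 // => i _; rewrite mul0r expr0n.
  under eq_bigr => i _ do rewrite mulr1n mul1r.
  have := noise_sqr_ge (sign f) x (enum_uniq 'I_n) rho1.
  rewrite sign_sqr noise_cst big_enum /= => /le_trans; apply.
  by rewrite gerBl sqr_ge0.
have U0 : 0 <= \sum_i mean (fun x => u i x ^+ 2).
  by apply: sumr_ge0 => i _; apply: mean_ge0 => x; apply: sqr_ge0.
have W0 : 0 <= (1 - rho ^+ 2) * \sum_i mean (fun x => v i x ^+ 2).
  apply: mulr_ge0 => //.
  by apply: sumr_ge0 => i _; apply: mean_ge0 => x; apply: sqr_ge0.
have CS := ler_wpM2l r0 (sum_mean_CauchySchwarz u v).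
have := ler_pM U0 W0 U W.
rewrite exprMn; lra.
Qed.

(** With [g] the derivative, whose values are 0 and 1 in absolute value, and
[q = E (g * T g)], two applications of Cauchy-Schwarz localised on the support
of [g] give [q^4 <= Inf^3 * E (T g)^4], where the noise is at rate 1/4. The fourth
moment is at most [q^2] by [bonami], because [4 * (1/4)^2 = 1/4] is again the rate
that defines [q]. *)
Lemma level_influence f i :
  (level_poly coords (der i (sign f))).[4^-1] ^+ 2 <= Inf R f i ^+ 3.
Proof.
set g := der i (sign f); set q := (_).[_]; set h := noise 4^-1 coords g.
have q0 : 0 <= q by apply: horner_level_ge0; rewrite invr_ge0.
have g4 x : g x ^+ 2 * g x ^+ 2 = g x ^+ 2.
  by rewrite /g der_sign_sqr -natrM mulnb andbb.
have I0 : 0 <= Inf R f i by rewrite -mean_der_sign_sqr mean_ge0 // => x; apply: sqr_ge0.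
pose A := mean (fun x => g x ^+ 2 * h x ^+ 2).
have qE : q ^+ 2 <= Inf R f i * A.
  rewrite /q -[4^-1]mul1r -mean_noise noise1 -/h.
  have -> : (fun x => g x * h x) = fun x => g x * (g x ^+ 2 * h x).
    apply/funext => x; rewrite mulrA; congr (_ * _).
    rewrite /g /der /sign.
    by case: (x i); case: (f x); case: (f (flip x i)); rewrite /pm1; field.
  apply: le_trans (mean_CauchySchwarz _ _) _.
  rewrite mean_der_sign_sqr /A; apply: ler_wpM2l => //.
  by apply: ler_mean => x; rewrite exprMn expr2 g4.
have AE : A ^+ 2 <= Inf R f i * q ^+ 2.
  apply: le_trans (mean_CauchySchwarz _ _) _.
  have -> : (fun x => (g x ^+ 2) ^+ 2) = fun x => g x ^+ 2.
    by apply/funext => x; rewrite expr2 g4.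
  rewrite mean_der_sign_sqr; apply: ler_wpM2l => //.
  have := bonami 4^-1 (supported_coords g).
  rewrite (_ : 4 * 4^-1 ^+ 2 = 4^-1) -/h; last by field.
  rewrite (_ : (fun x => (h x ^+ 2) ^+ 2) = fun x => h x ^+ 4) //.
  by apply/funext => x; rewrite -exprM.
have A0 : 0 <= A by apply: mean_ge0 => x; rewrite mulr_ge0 ?sqr_ge0.
have [->|qn0] := eqVneq q 0; first by rewrite expr0n exprn_ge0.
have q2 : 0 < q ^+ 2 by rewrite exprn_gt0 // lt_def qn0.
rewrite -(ler_pM2r q2).
have : (q ^+ 2) ^+ 2 <= (Inf R f i * A) ^+ 2.
  by rewrite ler_sqr // nnegrE ?sqr_ge0 // mulr_ge0.
rewrite -expr2 => /le_trans; apply.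
by rewrite exprMn (exprSr _ 2) -[leRHS]mulrA; apply: ler_wpM2l; rewrite ?sqr_ge0.
Qed.

(** A nonempty boundary has measure at least [2^-n]; an empty one forces [f] to be
constant. *)
Lemma Var_le_side_boundary b f : Var R f <= 2 ^+ n * mu R (side_boundary b f).
Proof.
have cardE : #|cube n|%:R = 2 ^+ n :> R.
  by rewrite card_ffun card_bool card_ord natrX.
rewrite /mu cardE mulrC divfK ?expf_neq0 ?pnatr_eq0 //.
have [S0|/set0Pn/card_gt0P S0] := eqVneq (side_boundary b f) set0; last first.
  by apply: le_trans (Var_le1 f) _; rewrite ler1n.
rewrite S0 cards0.
have inv i x : f (flip x i) = f x.
  have /setP/(_ x) := S0; rewrite !inE => /existsPn/(_ i).
  have /setP/(_ (flip x i)) := S0; rewrite !inE => /existsPn/(_ i).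
  by rewrite flipK; case: (f x); case: (f (flip x i)); case: (b).
have sg : supported [::] (sign f) by move=> i _ x; rewrite /sign inv.
rewrite /Var -/(sign f) (supported_nil [ffun=> true] sg) mean_cst.
rewrite (_ : (fun y => (_ - _) ^+ 2) = fun=> 0) ?mean_cst //.
apply/funext => y; rewrite -/(sign f y) (supported_nil [ffun=> true] sg).
by rewrite subrr expr0n.
Qed.

End Boolean.

(** * Choosing the noise rate *)

(** Here [p] is a level polynomial, [p.[1] - p.[0]] the variance, and the two
subtracted terms bound the weight at levels at least [M] (by Markov's inequality
for the mean level) and at levels at most [d] (which the derivative at 1/4 damps
by at most [4 ^+ d]). What is left lies between [d] and [M], where a level [k]
contributes [k * rho ^+ k.-1 >= d * rho ^+ M]. The comparison holds coefficient
by coefficient. *)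
Lemma deriv_horner_ge (R : realFieldType) (p : {poly R}) (d M : nat) (rho : R) :
  (forall k, 0 <= p`_k) -> 0 <= rho <= 1 -> (0 < M)%N ->
  d%:R * rho ^+ M
    * (p.[1] - p.[0] - p^`().[1] / M%:R - 4 ^+ d * p^`().[4^-1])
  <= p^`().[rho].
Proof.
move=> p0 /andP[r0 r1] M0.
have dE t : p^`().[t] = \sum_(k < size p) p`_k.+1 * k.+1%:R * t ^+ k.
  rewrite (@horner_coef_wide _ (size p)); last first.
    by have [->|/lt_size_deriv/ltnW//] := eqVneq p 0; rewrite deriv0 size_poly0.
  by apply: eq_bigr => k _; rewrite coef_deriv mulr_natr.
have -> : p.[1] - p.[0] = \sum_(k < size p) p`_k.+1.
  rewrite (@horner_coef_wide _ (size p).+1) // big_ord_recl horner_coef0.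
  rewrite expr0 mulr1 addrC addKr; apply: eq_bigr => k _.
  by rewrite expr1n mulr1.
rewrite !dE mulr_suml mulr_sumr -!sumrB mulr_sumr; apply: ler_sum => k _.
rewrite expr1n mulr1.
have -> : d%:R * rho ^+ M * (p`_k.+1 - p`_k.+1 * k.+1%:R / M%:R
       - 4 ^+ d * (p`_k.+1 * k.+1%:R * 4^-1 ^+ k))
   = p`_k.+1 * (d%:R * rho ^+ M *
       (1 - k.+1%:R / M%:R - 4 ^+ d * 4^-1 ^+ k * k.+1%:R)) by ring.
rewrite -[leRHS]mulrA; apply: ler_wpM2l => //.
have low0 : 0 <= 4 ^+ d * 4^-1 ^+ k * k.+1%:R :> R.
  by rewrite !mulr_ge0 ?exprn_ge0 ?invr_ge0.
have high0 : 0 <= k.+1%:R / M%:R :> R by rewrite divr_ge0.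
have dM0 : 0 <= d%:R * rho ^+ M by rewrite mulr_ge0 ?exprn_ge0.
have rhs0 : 0 <= k.+1%:R * rho ^+ k by rewrite mulr_ge0 ?exprn_ge0.
have [kd|dk] := leqP k d.
  apply: le_trans rhs0; apply: mulr_ge0_le0 => //.
  suff : 1 <= 4 ^+ d * 4^-1 ^+ k * k.+1%:R :> R by lra.
  rewrite -{1}(subnK kd) exprD -(mulrA (4 ^+ _)) -exprMn mulfV ?pnatr_eq0 //.
  by rewrite expr1n mulr1 mulr_ege1 ?exprn_ege1 ?ler1n.
have [Mk|kM] := leqP M k.+1.
  apply: le_trans rhs0; apply: mulr_ge0_le0 => //.
  suff : 1 <= k.+1%:R / M%:R :> R by lra.
  by rewrite ler_pdivlMr ?ltr0n // mul1r ler_nat.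
apply: (@le_trans _ _ (d%:R * rho ^+ M)).
  by rewrite -[leRHS]mulr1 ler_wpM2l //; lra.
apply: ler_pM; rewrite ?exprn_ge0 ?ler_nat //; first by rewrite ltnW // ltnS ltnW.
by rewrite ler_wiXn2l // ltnW // ltnW.
Qed.

Lemma bernoulli_sub (R : realDomainType) (x : R) k :
  0 <= x <= 1 -> 1 - k%:R * x <= (1 - x) ^+ k.
Proof.
move=> /andP[x0 x1]; elim: k => [|k IH]; first by rewrite mul0r subr0 expr0.
rewrite exprS -natr1.
have k0 : 0 <= k%:R * x ^+ 2 by rewrite mulr_ge0 ?sqr_ge0.
have : (1 - x) * (1 - k%:R * x) <= (1 - x) * (1 - x) ^+ k.
  by rewrite ler_wpM2l // subr_ge0.
nra.
Qed.

Lemma sqrn_le_exp2 d : (d ^ 2 <= 2 ^ d.+1)%N.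
Proof.
elim: d => // d IH; have [d3|d3] := leqP 3 d.
  by rewrite -mulnn (expnS 2 d.+1); move: IH; rewrite -mulnn; nia.
by case: d d3 IH => [|[|[|]]].
Qed.

(** The quantitative core, with [d] in the role of the logarithm of [n]. The base 256
leaves room for three losses: [256 ^ d = 4 ^ d * 8 ^ d * 8 ^ d], where [4 ^ d]
absorbs the logarithmic factor of the influences, and the two factors [8 ^ d]
make the square root of an influence at most [8 ^- d], enough to beat the factor
[4 ^ d] lost on the low levels. The condition [128 * K <= d] says that [2 ^ d]
has overtaken the linear factor [64 * K * d]. *)
Lemma Var_le_side_boundary_log (R : realType) (n : nat) (f : cube n -> bool)
    (b : bool) (K d : nat) :
  (0 < K)%N -> (128 * K <= d)%N -> (256 ^ d <= n)%N ->
  (forall i, Inf R f i <= K%:R * Var R f * (16 * d%:R / n%:R)) ->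
  Var R f <= 2 ^+ 17 * K%:R ^+ 2 * mu R (side_boundary b f).
Proof.
move=> K0 Kd dn infl.
have d0 : (0 < d)%N by lia.
have n0 : (0 < n)%N by apply: leq_trans dn; rewrite expn_gt0.
have n0R : 0 < n%:R :> R by rewrite ltr0n.
have V0 := Var_ge0 R f; have V1 := Var_le1 R f.
have mu0 : 0 <= mu R (side_boundary b f) by rewrite /mu divr_ge0.
have hM : (64 * K * d <= 2 ^ d)%N by have := sqrn_le_exp2 d; rewrite -mulnn expnS; nia.
set V := Var R f in infl V0 V1 *; set m := mu R _ in mu0 *.
pose p := spectrum R f; pose D : R := 16 * K%:R * d%:R.
have D0 : 0 <= D by rewrite /D !mulr_ge0.
have D2 : 4 * D <= 2 ^+ d.
  by rewrite /D -natrX (le_trans _ (_ : (64 * K * d)%:R <= _)) ?ler_nat // !natrM; lra.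
have infl' i : Inf R f i <= D * V / n%:R.
  apply: le_trans (infl i) _; rewrite le_eqVlt; apply/orP; left; apply/eqP.
  by rewrite /D; field; rewrite gt_eqF.
have inf0 i : 0 <= Inf R f i by rewrite /Inf /mu divr_ge0.
have I1 : \sum_i Inf R f i <= D * V.
  have -> : D * V = \sum_(i < n) D * V / n%:R.
    by rewrite sumr_const card_ord -[RHS]mulr_natr divfK ?gt_eqF.
  exact: ler_sum.
have inf_small i : Inf R f i <= (8 ^- d) ^+ 2.
  apply: le_trans (infl' i) _; rewrite ler_pdivrMr //.
  have nR : 4 ^+ d * 8 ^+ d * 8 ^+ d <= n%:R :> R.
    by rewrite -!exprMn -natrM -natrM -natrX ler_nat.
  have p8 : 0 < 8 ^+ d :> R by rewrite exprn_gt0.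
  have e2 : 2 ^+ d <= 4 ^+ d :> R by rewrite lerXn2r ?nnegrE //; lra.
  have DV : D * V <= 4 ^+ d by apply: le_trans (ler_piMr D0 V1) _; lra.
  rewrite expr2 -invfM [leRHS]mulrC ler_pdivlMr ?mulr_gt0 //.
  apply: le_trans nR; rewrite -mulrA; apply: ler_wpM2r => //.
  by rewrite mulr_ge0 // ltW.
(* The levels up to [d] carry at most a quarter of the variance. *)
have low : 4 ^+ d * p^`().[4^-1] <= V / 4.
  have q_le i : (level_poly (enum 'I_n) (der i (sign R f))).[4^-1] <= Inf R f i * 8 ^- d.
    rewrite -ler_sqr ?nnegrE; last 2 first.
    - by apply: horner_level_ge0; rewrite invr_ge0.
    - by rewrite mulr_ge0 // invr_ge0 exprn_ge0.
    apply: le_trans (level_influence R f i) _.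
    by rewrite [leRHS]exprMn (exprSr _ 2) ler_wpM2l ?sqr_ge0.
  have : p^`().[4^-1] <= D * V * 8 ^- d.
    rewrite /p deriv_spectrum; apply: le_trans (ler_sum _ (fun i _ => q_le i)) _.
    by rewrite -mulr_suml ler_wpM2r // invr_ge0 exprn_ge0.
  move=> /(ler_wpM2l (exprn_ge0 d (ler0n R 4))) /le_trans; apply.
  have e8 : 8 ^+ d = 4 ^+ d * 2 ^+ d :> R by rewrite -exprMn -natrM.
  have p2 : 0 < 2 ^+ d :> R by rewrite exprn_gt0.
  have p4 : 0 < 4 ^+ d :> R by rewrite exprn_gt0.
  have -> : 4 ^+ d * (D * V * 8 ^- d) = D * V / 2 ^+ d.
    by rewrite e8; field; rewrite !gt_eqF.
  rewrite ler_pdivrMr //; nra.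
pose M := (64 * K * d)%N.
have M0 : (0 < M)%N by rewrite /M !muln_gt0 K0.
have M0R : 1 <= M%:R :> R by rewrite ler1n.
have ME : M%:R = 4 * D by rewrite /M /D !natrM; ring.
(* This rate keeps [rho ^+ M >= 1/2], while [1 - rho ^+ 2] stays of order [1 / M]. *)
pose rho : R := 1 - (2 * M%:R)^-1.
have x01 : 0 <= (2 * M%:R : R)^-1 <= 1.
  by rewrite invr_ge0 invf_le1 ?mulr_ge0 //=; lra.
have rho01 : 0 <= rho <= 1 by rewrite /rho; lra.
have rhoM : 2^-1 <= rho ^+ M.
  apply: le_trans (bernoulli_sub M x01).
  rewrite le_eqVlt; apply/orP; left; apply/eqP; field.
  by rewrite gt_eqF //; lra.
have rho2 : (2 * M%:R)^-1 <= 1 - rho ^+ 2 by rewrite /rho; nra.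
have := deriv_horner_ge d (level_poly_ge0 (enum 'I_n) (sign R f)) rho01 M0.
rewrite -/(spectrum R f) -Var_spectrum -/V -/p.
(* The levels from [M] on carry at most a quarter of the variance. *)
have high : p^`().[1] / M%:R <= V / 4.
  rewrite /p deriv_spectrum1 ler_pdivrMr ?(lt_le_trans _ M0R) // ME.
  by apply: le_trans I1 _; nra.
move=> big.
have {}big : d%:R * V / 4 <= p^`().[rho].
  apply: le_trans big.
  apply: (@le_trans _ _ (d%:R * 2^-1 * (V / 2))); first by lra.
  apply: ler_pM; rewrite ?mulr_ge0 ?divr_ge0 ?invr_ge0 //; last by lra.
  by rewrite ler_wpM2l.
have rho2le1 : rho ^+ 2 <= 1 by nra.
have := side_boundary_ge b f rho2le1; rewrite -/p -/m => iso.
have dV0 : 0 <= d%:R * V / 4 by rewrite divr_ge0 ?mulr_ge0.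
have step : (2 * M%:R)^-1 * (d%:R * V / 4) ^+ 2 <= 4 * (D * V) * m.
  apply: le_trans (_ : 4 * (\sum_i Inf R f i) * m <= _); last first.
    by rewrite ler_wpM2r // ler_wpM2l.
  apply: le_trans iso; apply: ler_pM => //; first by case/andP: x01.
    exact: sqr_ge0.
  by rewrite lerXn2r ?nnegrE ?dV0 ?(le_trans dV0 big).
have [->|Vn0] := eqVneq V 0; first by apply: mulr_ge0 => //; rewrite mulr_ge0 ?exprn_ge0.
have Vpos : 0 < V by rewrite lt_def Vn0.
have dR : 0 < d%:R :> R by rewrite ltr0n.
have scale : 0 < 32 * M%:R / (V * d%:R ^+ 2).
  by rewrite divr_gt0 ?mulr_gt0 ?exprn_gt0 // (lt_le_trans _ M0R).
have := ler_wpM2l (ltW scale) step.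
have -> : 32 * M%:R / (V * d%:R ^+ 2) * ((2 * M%:R)^-1 * (d%:R * V / 4) ^+ 2) = V.
  by field; rewrite Vn0 !gt_eqF // (lt_le_trans _ M0R).
move=> /le_trans; apply; rewrite le_eqVlt; apply/orP; left; apply/eqP.
by rewrite ME /D; field; rewrite Vn0 gt_eqF.
Qed.

Lemma ln_le_exponent (R : realType) (n d : nat) :
  (0 < d)%N -> (0 < n)%N -> (n < 256 ^ d.+1)%N -> ln (n%:R : R) <= 16 * d%:R.
Proof.
move=> d0 n0 nd.
have h2 : ln (2 : R) <= 1 by rewrite (_ : 2 = 1 + 1) //; apply: le_ln1Dx; lra.
have : ln (n%:R : R) <= ln (2 ^+ (8 * d.+1)).
  rewrite ler_ln ?posrE ?exprn_gt0 ?ltr0n // exprM -natrX -natrX ler_nat.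
  exact: ltnW.
move=> /le_trans; apply; rewrite lnXn // -[_ *+ _]mulr_natr natrM.
have d1 : d.+1%:R <= 2 * d%:R :> R by rewrite -natrM ler_nat; lia.
have d2 : 0 <= d.+1%:R :> R by [].
nra.
Qed.

Theorem corollary7 (R : realType) (C : R) (hC : 0 < C) :
  exists2 cKKL : R, 0 < cKKL &
    forall (n : nat) (f : cube n -> bool),
      (1 <= n)%N ->
      C <= Num.sqrt (n%:R : R) ->
      (forall i : 'I_n, Inf R f i <= C * Var R f * (ln (n%:R : R) / n%:R)) ->
      mu R (inner_boundary f) >= cKKL * Var R f /\
      mu R (outer_boundary f) >= cKKL * Var R f.
Proof.
pose K := (Num.truncn C).+1.
have CK : C <= K%:R by rewrite ltW // truncnS_gt.
have KR : 0 < K%:R :> R by rewrite ltr0n.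
(* [n < N] whenever [trunc_log 256 n] is below the threshold of the core estimate.
   Only this equation is kept, so that the power is never computed. *)
have [N NE] : {N : nat | N = (256 ^ (128 * K))%N} by eexists.
pose A : R := 2 ^+ 17 * K%:R ^+ 2 + 2 ^+ N.
have A17 : 0 <= 2 ^+ 17 * K%:R ^+ 2 :> R by rewrite mulr_ge0 ?exprn_ge0 ?ltW.
have AN : 0 < 2 ^+ N :> R by rewrite exprn_gt0.
have A0 : 0 < A by rewrite /A ltr_wpDl.
exists A^-1; first by rewrite invr_gt0.
move=> n f n1 _ infl.
suff H b : A^-1 * Var R f <= mu R (side_boundary b f).
  by split; [exact: (H true) | exact: (H false)].
have mu0 : 0 <= mu R (side_boundary b f) by rewrite /mu divr_ge0.
rewrite mulrC ler_pdivrMr // mulrC /A mulrDl.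
pose d := trunc_log 256 n.
have dn : (256 ^ d <= n)%N by apply: trunc_logP.
have nd : (n < 256 ^ d.+1)%N by apply: trunc_log_ltn.
have [Kd|dK] := leqP (128 * K) d.
  rewrite -[leLHS]addr0; apply: lerD; last exact: mulr_ge0 (ltW AN) mu0.
  apply: (@Var_le_side_boundary_log _ _ _ _ K d) => // i.
  apply: le_trans (infl i) _.
  have n0R : 0 < n%:R :> R by rewrite ltr0n.
  have V0 := Var_ge0 R f.
  apply: ler_pM.
  - by rewrite mulr_ge0 // ltW.
  - by rewrite divr_ge0 // ln_ge0 // ler1n.
  - by rewrite ler_wpM2r.
  rewrite ler_wpM2r ?invr_ge0 //; apply: ln_le_exponent => //.
  by rewrite (leq_trans _ Kd).
rewrite -[leLHS]add0r; apply: lerD; first by rewrite mulr_ge0.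
apply: le_trans (Var_le_side_boundary R b f) _; rewrite ler_wpM2r //.
rewrite ler_eXn2l ?ltr1n //; apply: ltnW; apply: leq_trans nd _.
by rewrite NE leq_pexp2l.
Qed.
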